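(* For any integers $p\geq q\geq 3$ there exists an integer $C=C(p,q)$ such that the following holds. Let $\mathcal{F}$ be a finite family of non-empty open connected sets in the plane $\mathbb{R}^2$ satisfying the condition that the intersection of any members of $\mathcal{F}$ is empty or connected. If $\mathcal{F}$ has the $(p,q)$ property, then the piercing number of $\mathcal{F}$ is at most $C$.
   Context: For positive integers $p\geq q$, a family of sets $\mathcal{F}$ has the $(p,q)$ property if among any $p$ members of $\mathcal{F}$ there are some $q$ that are intersecting, that is, $q$ members whose intersection is non-empty. The piercing number of $\mathcal{F}$ is the minimal number $k$ such that $\mathcal{F}$ can be partitioned into $k$ intersecting subfamilies, where a subfamily is intersecting if the intersection of all its members is non-empty. *)

(* Defs.v *)
From mathcomp Require Import all_boot all_order all_algebra.
From mathcomp Require Import all_classical all_reals all_analysis.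
Import numFieldNormedType.Exports.

Set Implicit Arguments.
Unset Strict Implicit.
Unset Printing Implicit Defensive.

Local Open Scope classical_set_scope.
Local Open Scope card_scope.

Definition intersecting {T : Type} (F : set (set T)) : Prop :=
  \bigcap_(X in F) X !=set0.

(* The members picked are pairwise distinct: a family is a set of sets. *)
Definition pq_property {T : Type} (p q : nat) (F : set (set T)) : Prop :=
  forall A : set (set T), A `<=` F -> A #= `I_p ->
    exists B : set (set T), [/\ B `<=` A, B #= `I_q & intersecting B].

(* [partition] asks for pairwise disjoint non-empty blocks with union F, so
   there are exactly k blocks; the empty family has piercing number 0. *)
Definition pierceable {T : Type} (F : set (set T)) (k : nat) : Prop :=
  exists2 G : nat -> set (set T),
    partition `I_k G F & forall i : nat, `I_k i -> intersecting (G i).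

(* A relation rather than a function, since a family with an empty member
   has no piercing number. *)
Definition is_piercing_number {T : Type} (F : set (set T)) (k : nat) : Prop :=
  pierceable F k /\ forall j : nat, pierceable F j -> (k <= j)%N.

(* Main.v *)
Require Import Defs.
From mathcomp Require Import all_boot all_order all_algebra.
From mathcomp Require Import all_classical all_reals all_analysis.
From mathcomp Require Import lra zify.
From Stdlib Require Import Ring Bool.
Import numFieldNormedType.Exports.

(** The topological input is that K5 is not planar: if five points of the plane are joined in
    pairs by open connected sets, then two of these sets that join disjoint pairs of points
    meet ([K5_crossing]). Everything else is combinatorics of the class G of all intersections
    of members of the family, which consists of open connected sets (or the empty set) and is
    closed under intersection.

    Nonplanarity of K5 is used twice. Among any five points two disjoint pairs have hulls
    (relative to G) that meet, so the Radon number is at most five ([plane_radon]). And among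
    three classes of five sets, if any choice of one set from each class has a common point,
    then some four of the fifteen sets have one ([plane_quadruple_among_fifteen]).

    The first fact makes G behave like convex sets in a space of some dimension: it gives a
    Helly theorem, a Tverberg theorem and from it a colourful Helly theorem with a large number
    m of colours ([colourful_helly]). Colourful Helly is a forbidden-substructure property of
    the hypergraph of intersecting m-tuples, and a hypergraph of positive density with this
    property contains a clique of linear size ([thick_clique]); by Helly this is a fractional
    Helly theorem for m-tuples. The second fact lowers m to 3: a positive density of
    intersecting k-tuples, with k at least 3, forces a positive density of intersecting
    (k+1)-tuples, because a blow-up of a dense 3-partite system contains the fifteen sets
    above. This gives fractional Helly for triples ([fractional_helly]).

    The rest follows Alon and Kleitman. The (p,q) property makes a positive proportion of
    triples intersect, in every multiset of members, so every weighting of the family has a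
    point that lies in a fixed proportion of the total weight. Multiplicative weights turn this
    into a finite multiset of points of which every member contains a fixed proportion
    ([fractional_cover]). Then a weak epsilon-net argument, where a point deep in the hulls of
    tuples of these points comes from Tverberg and fractional Helly, yields boundedly many
    points that meet every member ([weak_net]). *)

Import Order.TTheory GRing.Theory Num.Theory.

Set Implicit Arguments.
Unset Strict Implicit.
Unset Printing Implicit Defensive.

(** * Crossings of polygonal paths modulo 2 *)
Section Crossing.
Local Open Scope classical_set_scope.
Variable R : realType.
Local Notation point := (R * R)%type.
Implicit Types (p q x y z : point) (s t : seq point) (E : set point).

Definition ltx p q : bool := (p.1 < q.1)%R.
Definition lty p q : bool := (p.2 < q.2)%R.

(** A step from p to p' stands for the elbow that first goes horizontally and then vertically.
    This is the parity of the number of crossings of two elbows, a horizontal side of one against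
    a vertical side of the other. Ties are always resolved as if the first path were moved
    slightly up and to the right, so that the parity is exact in degenerate positions as well. *)
Definition step_cross p p' q q' : bool :=
  (ltx p q' (+) ltx p' q') && (lty p q (+) lty p q')
  (+) ((ltx p' q (+) ltx p' q') && (lty p q (+) lty p' q)).

(** The sum of [fst_end p] along a path is the parity of its crossings with the horizontal ray
    from p to the right; similarly [snd_end _ _ q] belongs to the ray from q to the left. The
    crossing parity of two steps is the coboundary of this pair of cochains. *)
Definition fst_end p q q' : bool :=
  ltx p q' && lty p q (+) (ltx p q' && lty p q').

Definition snd_end p p' q : bool :=
  ltx p' q && lty p q (+) (ltx p' q && lty p' q).

Lemma step_crossE p p' q q' :
  step_cross p p' q q' = fst_end p q q' (+) fst_end p' q q'
                         (+) (snd_end p p' q (+) snd_end p p' q').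
Proof.
rewrite /step_cross /fst_end /snd_end.
by case: (ltx p q'); case: (ltx p' q'); case: (ltx p' q); case: (lty p q);
   case: (lty p q'); case: (lty p' q); case: (lty p' q').
Qed.

Fixpoint sum_steps (g : point -> point -> bool) x s : bool :=
  if s is y :: s' then g x y (+) sum_steps g y s' else false.

Lemma eq_sum_steps g g' x s : (forall y z, g y z = g' y z) ->
  sum_steps g x s = sum_steps g' x s.
Proof. by move=> e; elim: s x => //= y s IH x; rewrite e IH. Qed.

Lemma sum_stepsD g g' x s :
  sum_steps (fun y z => g y z (+) g' y z) x s
  = sum_steps g x s (+) sum_steps g' x s.
Proof. by elim: s x => //= y s IH x; rewrite IH addbACA. Qed.

Lemma sum_steps_telescope (h : point -> bool) x s :
  sum_steps (fun y z => h y (+) h z) x s = h x (+) h (last x s).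
Proof.
elim: s x => [|y s IH] x /=; first by rewrite addbb.
by rewrite IH -addbA (addbA (h y)) addbb.
Qed.

Definition path_cross x s u t : bool :=
  sum_steps (fun p p' => sum_steps (step_cross p p') u t) x s.

(** Both sums telescope because the crossing parity of two steps is a coboundary; so two closed
    paths cross an even number of times, and for open paths only the endpoints matter. *)
Lemma path_cross_ends x s u t :
  path_cross x s u t
  = sum_steps (fst_end x) u t (+) sum_steps (fst_end (last x s)) u t
    (+) (sum_steps (fun p p' => snd_end p p' u) x s
         (+) sum_steps (fun p p' => snd_end p p' (last u t)) x s).
Proof.
pose h p := sum_steps (fst_end p) u t.
have step p p' : sum_steps (step_cross p p') u t
  = (h p (+) h p') (+) (snd_end p p' u (+) snd_end p p' (last u t)).
  rewrite (eq_sum_steps _ _ (fun q q' => step_crossE p p' q q')).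
  by rewrite 2!sum_stepsD sum_steps_telescope.
by rewrite /path_cross (eq_sum_steps _ _ step) sum_stepsD sum_steps_telescope
           sum_stepsD.
Qed.

Definition differ p q : bool := (p.1 != q.1) && (p.2 != q.2).

Lemma ltxN p q : differ p q -> ltx q p = ~~ ltx p q.
Proof. by rewrite /ltx -leNgt lt_def => /andP[-> _]. Qed.

Lemma ltyN p q : differ p q -> lty q p = ~~ lty p q.
Proof. by rewrite /lty -leNgt lt_def => /andP[_ ->]. Qed.

(** The rays from p to the left and to the right form a line, which a path crosses an odd number
    of times when exactly one of its ends is above p. This difference between the two positions
    is what makes the total crossing parity of K5 odd. *)
Lemma snd_end_fst_end p x s : all (differ p) (x :: s) ->
  sum_steps (fun q q' => snd_end q q' p) x s
  = sum_steps (fst_end p) x s (+) (lty p x (+) lty p (last x s)).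
Proof.
rewrite -[X in _ (+) X](sum_steps_telescope (lty p)) -sum_stepsD.
elim: s x => //= y s IH x /and3P[px py ps].
rewrite IH; last by rewrite /= py.
congr (_ (+) _); rewrite /snd_end /fst_end !(ltxN py) (ltyN px) (ltyN py).
by case: (ltx p y); case: (lty p x); case: (lty p y).
Qed.

Definition between (a b c : R) : Prop := (a <= c <= b)%R \/ (b <= c <= a)%R.

Definition elbow E p p' : Prop :=
  (forall c, between p.1 p'.1 c -> E (c, p.2)) /\
  (forall c, between p.2 p'.2 c -> E (p'.1, c)).

Fixpoint elbow_path E x s : Prop :=
  if s is y :: s' then elbow E x y /\ elbow_path E y s' else True.

Lemma xor_lt_between (a b c : R) : ((a < c)%R (+) (b < c)%R) -> between a b c.
Proof.
by rewrite /between; case: (ltP a c) => h1; case: (ltP b c) => h2 //= _;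
   [left|right]; rewrite ?h1 ?h2 ltW.
Qed.

Lemma xor_gt_between (a b c : R) : ((c < a)%R (+) (c < b)%R) -> between a b c.
Proof.
by rewrite /between; case: (ltP c a) => h1; case: (ltP c b) => h2 //= _;
   [right|left]; rewrite ?h1 ?h2 ltW.
Qed.

(** The corner points that witness an odd crossing lie on a horizontal side of one elbow and on a
    vertical side of the other. *)
Lemma step_cross_meet E E' p p' q q' : elbow E p p' -> elbow E' q q' ->
  step_cross p p' q q' -> E `&` E' !=set0.
Proof.
move=> [Eh Ev] [E'h E'v]; rewrite /step_cross.
case: (boolP (_ && _)) => [/andP[h1 h2] _|_ /= /andP[h1 h2]].
  exists (q'.1, p.2); split; first exact/Eh/xor_lt_between.
  exact/E'v/xor_gt_between.
exists (p'.1, q.2); split; first exact/Ev/xor_lt_between.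
exact/E'h/xor_gt_between.
Qed.

Lemma path_cross_disjoint E E' x s u t :
  E `&` E' = set0 -> elbow_path E x s -> elbow_path E' u t ->
  path_cross x s u t = false.
Proof.
move=> EE' Es Et.
suff step p p' v r : elbow E p p' -> elbow_path E' v r ->
    sum_steps (step_cross p p') v r = false.
  elim: s x Es => //= y s IH x [Exy Es].
  by rewrite /path_cross /= step //; exact: IH.
move=> Epp'; elim: r v => //= w r IH v [E'vw E'r]; rewrite IH //.
case: (boolP (step_cross _ _ _ _)) => // /(step_cross_meet Epp' E'vw).
by rewrite EE' => -[].
Qed.

Lemma addb_xorb (b c : bool) : b (+) c = xorb b c.
Proof. by case: b; case: c. Qed.

Lemma negb_xorb (b : bool) : ~~ b = xorb true b.
Proof. by []. Qed.

(** The van Kampen parity argument. In the intended use [a m i j] is the parity with which edge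
    ij crosses the ray from vertex m to the right, and [y] compares heights. Each [a m i j]
    occurs in exactly two of the fifteen equations, one for each vertex other than i, j and m, so
    it cancels in their sum; each comparison occurs six times, and the negations that bring it to
    a fixed direction contribute an odd total. *)
Lemma five_vertices_parity (a : nat -> nat -> nat -> bool) (y : nat -> nat -> bool) :
  (forall i j, (i < j < 5)%N -> y j i = ~~ y i j) ->
  ~ forall i j k l, (i < j < 5)%N -> (k < l < 5)%N -> uniq [:: i; j; k; l] ->
    a i k l (+) a j k l (+) (a k i j (+) (y k i (+) y k j)
      (+) (a l i j (+) (y l i (+) y l j))) = false.
Proof.
move=> yN sep.
have := yN 0 1 isT; have := yN 0 2 isT; have := yN 0 3 isT; have := yN 0 4 isT.
have := yN 1 2 isT; have := yN 1 3 isT; have := yN 1 4 isT.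
have := yN 2 3 isT; have := yN 2 4 isT; have := yN 3 4 isT.
move=> y34 y24 y23 y14 y13 y12 y04 y03 y02 y01.
pose c i j k l := a i k l (+) a j k l (+) (a k i j (+) (y k i (+) y k j)
      (+) (a l i j (+) (y l i (+) y l j))).
have: c 0 1 2 3 (+) c 0 2 1 3 (+) c 0 3 1 2 (+)
      (c 0 1 2 4 (+) c 0 2 1 4 (+) c 0 4 1 2) (+)
      (c 0 1 3 4 (+) c 0 3 1 4 (+) c 0 4 1 3) (+)
      (c 0 2 3 4 (+) c 0 3 2 4 (+) c 0 4 2 3) (+)
      (c 1 2 3 4 (+) c 1 3 2 4 (+) c 1 4 2 3) = true.
  rewrite /c y01 y02 y03 y04 y12 y13 y14 y23 y24 y34 !addb_xorb !negb_xorb.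
  ring.
by rewrite /c !sep.
Qed.

End Crossing.

(** * General position and K5 *)
Section OpenBigcap.
Local Open Scope classical_set_scope.

Lemma open_bigcap_finite (T : topologicalType) (I : choiceType) (A : set I)
    (U : I -> set T) : finite_set A -> (forall i, A i -> open (U i)) ->
  open (\bigcap_(i in A) U i).
Proof.
move=> finA oU; rewrite -[X in open X]setCK setC_bigcap; apply: closed_openC.
by apply: closed_bigcup => // i Ai; apply/open_closedC/oU.
Qed.

End OpenBigcap.

Section GeneralPosition.
Local Open Scope classical_set_scope.
Variable R : realType.
Local Notation point := (R * R)%type.
Implicit Types (p q x y z w : point) (s bad : seq point) (E : set point).

(** One value of the list is avoided at a time, by passing to a smaller interval. *)
Lemma avoid_reals (s : seq R) (a e : R) : (0 < e)%R ->
  exists2 c : R, (`|a - c| < e)%R & c \notin s.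
Proof.
elim: s a e => [|b s IH] a e e0; first by exists a; rewrite ?subrr ?normr0.
have [a' aa' a'b] : exists2 a' : R, (`|a - a'| <= e / 2)%R & a' != b.
  have [->|ab] := eqVneq a b.
    exists (b + e / 2)%R; last by apply/eqP; lra.
    by rewrite opprD addrA subrr sub0r normrN ger0_norm //; lra.
  by exists a => //; rewrite subrr normr0; lra.
have r0 : (0 < Num.min (e / 2) `|a' - b|)%R.
  by rewrite lt_min normr_gt0 subr_eq0 a'b andbT; lra.
have [c] := IH a' _ r0; rewrite lt_min => /andP[c1 c2] cs.
exists c; first by have := ler_distD a' a c; lra.
rewrite in_cons negb_or cs andbT; apply/eqP => cb.
by move: c2; rewrite cb ltxx.
Qed.

Lemma ball_planeE x (e : R) y :
  ball x e y <-> (`|x.1 - y.1| < e)%R /\ (`|x.2 - y.2| < e)%R.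
Proof. by []. Qed.

Definition generic bad q : bool := all (fun p => differ p q) bad.

Lemma generic_in_ball bad x (e : R) : (0 < e)%R ->
  exists2 q, ball x e q & generic bad q.
Proof.
move=> e0.
have [c1 xc1 c1s] := avoid_reals [seq p.1 | p <- bad] x.1 e0.
have [c2 xc2 c2s] := avoid_reals [seq p.2 | p <- bad] x.2 e0.
exists (c1, c2); first exact/ball_planeE.
apply/allP => p ps; apply/andP; split; apply/eqP => /= pc.
  by move/negP: c1s; apply; rewrite -pc map_f.
by move/negP: c2s; apply; rewrite -pc map_f.
Qed.

Lemma generic_in_open bad (U : set point) : open U -> U !=set0 ->
  exists2 q, U q & generic bad q.
Proof.
move=> oU [x Ux].
have /nbhs_ballP[e /= e0 xe] : nbhs x U by exact: open_nbhs_nbhs.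
by have [q /xe] := generic_in_ball bad x e0; exists q.
Qed.

Lemma elbow_path_rcons E x s y :
  elbow_path E x (rcons s y) <-> elbow_path E x s /\ elbow E (last x s) y.
Proof.
elim: s x => [|z s IH] x /=; first by split=> -[].
by split=> [[h /IH[]]|[[h h'] ?]]; [|split=> //; apply/IH].
Qed.

Lemma elbow_in_ball E z (e : R) p q :
  ball z e `<=` E -> ball z e p -> ball z e q -> elbow E p q.
Proof.
move=> zE /ball_planeE[p1 p2] /ball_planeE[q1 q2].
move: p1 p2 q1 q2; rewrite !ltr_norml => /andP[? ?] /andP[? ?] /andP[? ?] /andP[? ?].
by split=> c [] /andP[? ?]; apply/zE/ball_planeE; split=> /=;
   rewrite ltr_norml; apply/andP; split; lra.
Qed.

Lemma ball_half x y (e : R) : ball x (e / 2) y -> ball y (e / 2) `<=` ball x e.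
Proof. by move=> xy z yz; rewrite [e]splitr; apply: ball_triangle xy yz. Qed.

(** The points near which generic points can be reached from x by elbows inside E form a subset
    that is open and closed in E. Intermediate points are kept generic because only the heights
    and abscissae of given points against them will be compared. *)
Lemma connected_elbow_path E bad x y : open E -> connected E -> E x -> E y ->
  exists2 s, elbow_path E x (rcons s y) & all (generic bad) s.
Proof.
move=> oE cE Ex Ey.
have Eball z : E z -> exists2 e : R, (0 < e)%R & ball z e `<=` E.
  move=> Ez; have /nbhs_ballP[e /= e0 h] : nbhs z E by exact: open_nbhs_nbhs.
  by exists e.
pose reach w := exists2 s, elbow_path E x (rcons s w) & all (generic bad) (rcons s w).
have reach_ball z (e : R) w w' : ball z e `<=` E -> ball z e w -> ball z e w' ->
    reach w -> generic bad w' -> reach w'.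
  move=> zE zw zw' [s sE sg] gw'; exists (rcons s w).
    apply/elbow_path_rcons; split=> //; rewrite last_rcons.
    exact: elbow_in_ball zw zw'.
  by rewrite all_rcons gw'.
(* By [reach_ball], if one point of a ball inside E is reached then so are all generic points of
   the ball, which makes C both open and relatively closed. *)
pose C z := exists2 e : R, (0 < e)%R /\ ball z e `<=` E & exists2 w, ball z e w & reach w.
have C_sub z : C z -> E z by move=> [e [e0 h] _]; apply/h/ballxx.
have Copen : open C.
  rewrite openE => z [e [e0 zE] [w zw rw]]; apply/nbhs_ballP.
  exists (e / 2)%R => /=; first by lra.
  move=> z1 zz1; have sub := ball_half zz1.
  have e20 : (0 < e / 2)%R by lra.
  exists (e / 2)%R; first by split=> // v /sub/zE.
  have [w1 z1w1 gw1] := generic_in_ball bad z1 e20.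
  by exists w1 => //; apply: (reach_ball z e w) => //; apply: sub.
have Dopen : open (E `\` C).
  rewrite openE => z [Ez nCz]; apply/nbhs_ballP.
  have [e e0 zE] := Eball z Ez.
  exists (e / 2)%R => /=; first by lra.
  move=> z1 zz1; have sub := ball_half zz1; split.
    by apply/zE/sub/ballxx; lra.
  move=> [d [d0 z1E] [w z1w rw]]; apply: nCz; exists e => //.
  have m0 : (0 < Num.min d (e / 2))%R by rewrite lt_min d0; lra.
  have [w1 z1w1 gw1] := generic_in_ball bad z1 m0.
  exists w1; first by apply: sub; apply: le_ball z1w1; rewrite ge_min lexx orbT.
  apply: (reach_ball z1 d w) => //.
  by apply: le_ball z1w1; rewrite ge_min lexx.
have CE : C = E.
  apply: cE.
  - exists x; have [e e0 xE] := Eball x Ex; exists e => //.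
    have [w xw gw] := generic_in_ball bad x e0.
    exists w => //; exists [::] => /=; last by rewrite gw.
    by split=> //; apply: (elbow_in_ball xE) => //; apply: ballxx.
  - exists C => //; apply/seteqP; split=> z; last by case.
    by move=> Cz; split=> //; apply: C_sub.
  - exists (~` (E `\` C)); first exact: open_closedC.
    apply/seteqP; split=> z.
      by move=> Cz; split; [exact: C_sub|case].
    by move=> [Ez h]; apply: contrapT => nCz; apply: h.
have : C y by rewrite CE.
move=> [e [e0 yE] [w yw [s sE sg]]]; exists (rcons s w) => //.
apply/elbow_path_rcons; split=> //; rewrite last_rcons.
by apply: (elbow_in_ball yE) => //; apply: ballxx.
Qed.

Lemma generic_choice (U : nat -> set point) n :
  (forall i, (i < n)%N -> open (U i) /\ U i !=set0) ->
  exists x : nat -> point, (forall i, (i < n)%N -> U i (x i)) /\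
    (forall i j, (i < j < n)%N -> differ (x i) (x j)).
Proof.
elim: n => [|n IH] hU; first by exists (fun=> 0%R); split=> // i j; lia.
have [i ni|x [xU xd]] := IH; first by apply: hU; lia.
have [q Uq gq] := generic_in_open (map x (iota 0 n))
  (proj1 (hU n (ltnSn n))) (proj2 (hU n (ltnSn n))).
exists (fun i => if i == n then q else x i); split=> [i|i j].
  by case: eqP => [->//|? ?]; apply: xU; lia.
case: eqP => [|_]; first by lia.
case: eqP => [_ ijn|? ?]; last by apply: xd; lia.
by move/allP: gq; apply; apply: map_f; rewrite mem_iota; lia.
Qed.

End GeneralPosition.

Section K5.
Local Open Scope classical_set_scope.
Variable R : realType.
Local Notation point := (R * R)%type.

Lemma differ_sym (p q : point) : differ p q = differ q p.
Proof. by rewrite /differ ![in LHS](eq_sym p.1) ![in LHS](eq_sym p.2). Qed.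

(** After moving the five points slightly into general position, join them by polygonal paths
    inside the given sets. If no two independent edges met, all fifteen crossing parities of
    independent paths would vanish, against [five_vertices_parity]. *)
Theorem K5_crossing (x : nat -> point) (E : nat -> nat -> set point) :
  (forall i j, (i < j < 5)%N -> [/\ open (E i j), connected (E i j), E i j (x i) & E i j (x j)]) ->
  exists i j k l, [/\ (i < j < 5)%N, (k < l < 5)%N, uniq [:: i; j; k; l]
    & E i j `&` E k l !=set0].
Proof.
(* Each x i may move inside the intersection U i of the open sets that end at it. *)
wlog xgen : x / forall i j, (i < j < 5)%N -> differ (x i) (x j).
  move=> gen hE.
  pose U i := \bigcap_(j in [set j | (j < 5)%N])
    ((if (i < j)%N then E i j else setT) `&` (if (j < i)%N then E j i else setT)).
  have [i i5|y [yU yd]] := @generic_choice R U 5.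
    split.
      apply: open_bigcap_finite => [|j j5]; first exact: finite_II.
      apply: openI; case: ifP => ij; try exact: openT.
        by case: (hE i j) => //; rewrite ij.
      by case: (hE j i) => //; rewrite ij.
    exists (x i) => j j5; split; case: ifP => // ij.
      by case: (hE i j) => //; rewrite ij.
    by case: (hE j i) => //; rewrite ij.
  apply: (gen y yd) => i j ij5; have [oE cE _ _] := hE i j ij5; split=> //.
    by have [] := yU i _ j _; rewrite /=; try lia; case: ifP => //; lia.
  by have [] := yU j _ i _; rewrite /=; try lia; case: ifP => //; [|case: ifP => //]; lia.
move=> hE; apply: contrapT => sep.
pose bad := map x (iota 0 5).
have xgen' i j : (i < 5)%N -> (j < 5)%N -> i != j -> differ (x i) (x j).
  move=> i5 j5; rewrite neq_ltn => /orP[ij|ji]; first by apply: xgen; lia.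
  by rewrite differ_sym; apply: xgen; lia.
have /choice[P hP] : forall ij : nat * nat, exists s, (ij.1 < ij.2 < 5)%N ->
    elbow_path (E ij.1 ij.2) (x ij.1) (rcons s (x ij.2)) /\ all (generic bad) s.
  move=> [i j] /=; case: (boolP (i < j < 5)%N) => ij; last by exists [::].
  have [oE cE Ei Ej] := hE i j ij.
  by have [s s1 s2] := connected_elbow_path bad oE cE Ei Ej; exists s.
pose Q i j := rcons (P (i, j)) (x j).
have Qlast i j z : last z (Q i j) = x j by rewrite last_rcons.
have Qdiffer m i j : (i < j < 5)%N -> (m < 5)%N -> m != i -> m != j ->
    all (differ (x m)) (x i :: Q i j).
  move=> ij m5 mi mj; rewrite /= all_rcons !xgen' //; try lia.
  have [_ /allP g] := hP (i, j) ij; apply/allP => q /g /allP; apply.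
  by apply: map_f; rewrite mem_iota.
pose a m i j := sum_steps (fst_end (x m)) (x i) (Q i j).
pose y i j := lty (x i) (x j).
apply: (@five_vertices_parity a y).
  by move=> i j ij; apply/ltyN/xgen.
move=> i j k l ij kl u.
have cross0 : path_cross (x i) (Q i j) (x k) (Q k l) = false.
  apply: (@path_cross_disjoint _ (E i j) (E k l)).
  - apply/eqP/negPn/negP => /set0P n0; apply: sep.
    by exists i, j, k, l; split.
  - by have [] := hP (i, j) ij.
  - by have [] := hP (k, l) kl.
move: cross0; rewrite path_cross_ends !Qlast.
rewrite !snd_end_fst_end ?Qlast //.
  by apply: Qdiffer; move: u; rewrite /= !inE; lia.
by apply: Qdiffer; move: u; rewrite /= !inE; lia.
Qed.

End K5.

(** * Density *)

(** Density at least 1/C; a natural denominator keeps all the counting inside nat. *)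
Definition thick (X : finType) (C : nat) (E : pred X) : bool := (#|X| <= C * #|E|)%N.

Section Density.
Local Open Scope nat_scope.
Implicit Types (X Y I J L : finType) (C D : nat).

Lemma thick_sub X C C' (E E' : pred X) :
  C <= C' -> (forall x, E x -> E' x) -> thick C E -> thick C' E'.
Proof.
move=> CC' EE' /leq_trans; apply; apply: leq_mul => //.
by apply: subset_leq_card; apply/fintype.subsetP => x; apply: EE'.
Qed.

Lemma thick_witness X C (E : pred X) : 0 < #|X| -> thick C E -> exists x, E x.
Proof.
move=> X0 dE; have /card_gt0P[x Ex] : 0 < #|E|; last by exists x.
by rewrite lt0n; apply: contraTneq dE; rewrite /thick => ->; rewrite muln0 -ltnNge.
Qed.

Lemma card_comp_bij X Y (s : X -> Y) (E : pred Y) : bijective s ->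
  #|[pred x | E (s x)]| = #|E|.
Proof.
move=> bs; rewrite -!sum1_card (reindex s) /=; last exact: onW_bij.
by apply: eq_bigl.
Qed.

Lemma thick_comp_bij X Y (s : X -> Y) C (E : pred Y) : bijective s ->
  thick C [pred x | E (s x)] = thick C E.
Proof. by move=> bs; rewrite /thick card_comp_bij // (bij_eq_card bs). Qed.

Lemma card_pairs X Y (E : X -> Y -> bool) :
  #|[pred u : X * Y | E u.1 u.2]| = \sum_x #|E x|.
Proof.
rewrite -sum1_card (eq_bigr (fun x => \sum_(y | E x y) 1)); last first.
  by move=> x _; rewrite -sum1_card; apply: eq_bigl.
by rewrite pair_big_dep /=; apply: eq_bigl.
Qed.

Lemma thick_swap X Y C (E : X -> Y -> bool) :
  thick C [pred u : X * Y | E u.1 u.2] = thick C [pred u : Y * X | E u.2 u.1].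
Proof.
have bs : bijective (fun u : X * Y => (u.2, u.1)).
  by exists (fun u => (u.2, u.1)); case.
by rewrite -(thick_comp_bij _ _ bs).
Qed.

(** Fibres of density below 1/(2C) account for at most half of the guaranteed total. *)
Lemma thick_fibers X Y C (E : X -> Y -> bool) : 0 < #|Y| ->
  thick C [pred u : X * Y | E u.1 u.2] -> thick (2 * C) [pred x | thick (2 * C) (E x)].
Proof.
move=> Y0; rewrite /thick card_prod card_pairs => dE.
set H := #|_|; rewrite -(leq_pmul2l Y0).
have : 2 * C * \sum_x #|E x| <= 2 * C * #|Y| * H + #|X| * #|Y|.
  rewrite big_distrr /= (bigID [pred x | #|Y| <= 2 * C * #|E x|]) /=.
  apply: leq_add.
    rewrite [leqRHS]mulnC /H -sum_nat_const big_mkcond [leqRHS]big_mkcond /=.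
    by apply: leq_sum => x _; rewrite inE; case: ifP => // _; rewrite leq_mul2l max_card orbT.
  rewrite -sum_nat_const big_mkcond /=; apply: leq_sum => x _.
  by case: ifP => //; rewrite -ltnNge => /ltnW.
by move: dE; nia.
Qed.

Lemma thick_pairs X Y C D (E : X -> Y -> bool) :
  thick C [pred x | thick D (E x)] -> thick (C * D) [pred u : X * Y | E u.1 u.2].
Proof.
rewrite /thick card_prod card_pairs => dH.
apply: leq_trans (leq_mul dH (leqnn _)) _.
rewrite -!mulnA leq_mul2l; apply/orP; right.
rewrite -sum1_card big_distrl big_distrr /= big_mkcond /=.
by apply: leq_sum => x _; rewrite inE; case: ifP => //; rewrite mul1n.
Qed.

Lemma thick_pigeonhole X Y C (E : pred X) (P : X -> Y -> bool) : 0 < #|X| ->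
  thick C E -> (forall x, E x -> exists y, P x y) ->
  exists y, thick (C * #|Y|) (P^~ y).
Proof.
move=> X0 dE EP; apply: contrapT => none.
have [x0 Ex0] := thick_witness X0 dE; have [y0 _] := EP x0 Ex0.
have Y0 : 0 < #|Y| by apply/card_gt0P; exists y0.
have sumP : #|E| <= \sum_y #|P^~ y|.
  rewrite -(card_pairs (fun y x => P x y)).
  have bs : bijective (fun u : X * Y => (u.2, u.1)) by exists (fun u => (u.2, u.1)); case.
  rewrite -(card_comp_bij _ bs) /= (card_pairs P) -sum1_card big_mkcond /=.
  apply: leq_sum => x _; case: ifP => // /EP[y Pxy].
  by apply/card_gt0P; exists y.
have : #|Y| * (C * \sum_y #|P^~ y|) < #|Y| * #|X|.
  rewrite mulnA [#|Y| * C]mulnC big_distrr -sum_nat_const /=.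
  rewrite (bigD1 y0) // [ltnRHS](bigD1 y0) //= -addSn.
  have small y : C * #|Y| * #|P^~ y| < #|X|.
    by rewrite ltnNge; apply/negP => dP; apply: none; exists y.
  by apply: leq_add => //; apply: leq_sum => y _; apply: ltnW.
by rewrite ltn_pmul2l // ltnNge (leq_trans dE) // leq_mul2l sumP orbT.
Qed.

(** The restriction of a uniformly random map along an injection is uniformly random. The proof
    exchanges the values on the image of h between a map on L and a map on J, which is an
    involution. *)
Lemma thick_ffun_comp J L I C (h : L -> J) (P : pred {ffun L -> I}) :
  0 < #|I| -> injective h ->
  thick C [pred G : {ffun J -> I} | P [ffun a => G (h a)]] = thick C P.
Proof.
move=> I0 hI.
pose paste (u : {ffun L -> I}) (G : {ffun J -> I}) : {ffun J -> I} :=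
  [ffun j => if [pick a | h a == j] is Some a then u a else G j].
have pasteE u G a : paste u G (h a) = u a.
  by rewrite ffunE; case: pickP => [b /eqP/hI->//|/(_ a)/eqP].
pose exch (v : {ffun L -> I} * {ffun J -> I}) := ([ffun a => v.2 (h a)], paste v.1 v.2).
have exchK : cancel exch exch.
  move=> [u G]; congr (_, _); first by apply/ffunP => a; rewrite ffunE /= pasteE.
  apply/ffunP => j; rewrite ffunE /=; case: pickP => [a /eqP<-|nj].
    by rewrite ffunE.
  by rewrite ffunE; case: pickP => // a; rewrite nj.
have cards : #|I| ^ #|L| * #|[pred G : {ffun J -> I} | P [ffun a => G (h a)]]|
    = #|I| ^ #|J| * #|P|.
  have := card_comp_bij (fun v : {ffun L -> I} * {ffun J -> I} => P v.1) (Bijective exchK exchK).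
  rewrite (card_pairs (fun (u : {ffun L -> I}) (G : {ffun J -> I}) => P [ffun a => G (h a)])).
  rewrite (card_pairs (fun (u : {ffun L -> I}) (G : {ffun J -> I}) => P u)).
  rewrite sum_nat_const card_ffun => ->.
  rewrite -[X in _ * X]sum1_card big_distrr [RHS]big_mkcond /= muln1.
  apply: eq_bigr => u _; rewrite unfold_in; case: (P u); first by rewrite cardT -card_ffun cardT.
  by rewrite card0.
rewrite /thick !card_ffun.
(* Cross-multiply by both powers of the cardinal of I to cancel them without subtraction. *)
have IL : 0 < #|I| ^ #|L| by rewrite expn_gt0 I0.
have IJ : 0 < #|I| ^ #|J| by rewrite expn_gt0 I0.
by rewrite -[LHS](leq_pmul2l IL) mulnCA cards mulnCA [X in X <= _]mulnC leq_pmul2l.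
Qed.

(** In a fibre of density 1/(2C), all values of a random map fall into the fibre with probability
    at least (1/(2C)) to the power of the size of L. *)
Lemma thick_blow_up X I L C (E : X -> I -> bool) : 0 < #|I| ->
  thick C [pred u : X * I | E u.1 u.2] ->
  thick (2 * C * (2 * C) ^ #|L|)
    [pred u : X * {ffun L -> I} | [forall a, E u.1 (u.2 a)]].
Proof.
move=> I0 /(thick_fibers I0) dH.
apply: (thick_pairs (E := fun x (g : {ffun L -> I}) => [forall a, E x (g a)])).
apply: thick_sub dH => // x; rewrite /= /thick card_ffun => dx.
have -> : #|[pred g : {ffun L -> I} | [forall a, E x (g a)]]| = #|E x| ^ #|L|.
  by rewrite -card_ffun_on; apply: eq_card => g; apply/forallP/ffun_onP.
by rewrite -expnMn; have [->|L0] := posnP #|L|; rewrite ?expn0 ?leq_exp2r.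
Qed.

End Density.

(** * Large cliques in dense hypergraphs with a colourful Helly property *)
Section Cliques.
Local Open Scope nat_scope.
Implicit Types (I : finType).

Definition fcons I m (x : I) (y : {ffun 'I_m -> I}) : {ffun 'I_m.+1 -> I} :=
  [ffun j => oapp y x (unlift ord0 j)].

Lemma fcons_bij I m : bijective (fun u : I * {ffun 'I_m -> I} => fcons u.1 u.2).
Proof.
exists (fun g : {ffun 'I_m.+1 -> I} => (g ord0, [ffun j => g (lift ord0 j)])).
  move=> [x y]; rewrite /fcons /= ffunE unlift_none; congr (_, _).
  by apply/ffunP => j; rewrite !ffunE liftK.
move=> g; apply/ffunP => j; rewrite ffunE.
by case: unliftP => [i ->|->]; rewrite /= ?ffunE.
Qed.

(** Holmsen's argument, by induction on the number m of colours. For a tail y of an m-tuple let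
    N(y) be the set of first entries that complete it to an edge. If some large N(y) contains few
    missing k-tuples, it is the required set. Otherwise some missing k-tuple f lies in N(y) for a
    positive proportion of the y; the tails y all of whose completions by f are edges form a
    dense hypergraph, with one colour less, that inherits the colourful property. *)
Lemma few_missing_on_large_subset k D m C : exists C', forall I (E : pred {ffun 'I_m -> I})
    (miss : pred {ffun 'I_k -> I}), 0 < #|I| -> thick C E ->
  (forall f : 'I_m -> {ffun 'I_k -> I}, (forall i, miss (f i)) ->
    exists c : 'I_m -> 'I_k, ~~ E [ffun i => f i (c i)]) ->
  exists N : {set I}, #|I| <= C' * #|N| /\
    D * #|[pred f : {ffun 'I_k -> I} | miss f && [forall a, f a \in N]]| <= #|N| ^ k.
Proof.
elim: m C => [|m IH] C.
  (* The empty tuple is its own transversal, so the colourful property contradicts density. *)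
  exists 0 => I E miss I0 dE col.
  have [|g Eg] := thick_witness _ dE; first by rewrite card_ffun expn_gt0 I0.
  have f0 : 'I_0 -> {ffun 'I_k -> I} by case.
  have [|c] := col f0; first by case.
  by rewrite (_ : [ffun _ => _] = g) ?Eg //; apply/ffunP => -[].
pose C2 := 2 * C * ((2 * C) ^ k * D).
have [C' hC'] := IH (2 * C2).
exists (2 * C + C') => I E miss I0 dE col.
have Im m' : 0 < #|{ffun 'I_m' -> I}| by rewrite card_ffun expn_gt0 I0.
pose N (y : {ffun 'I_m -> I}) := [set x | E (fcons x y)].
have dH : thick (2 * C) [pred y | thick (2 * C) [pred x | E (fcons x y)]].
  apply: (thick_fibers I0 (E := fun y x => E (fcons x y))).
  by rewrite -(thick_swap _ (fun x y => E (fcons x y))) (thick_comp_bij _ _ (fcons_bij I m)).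
have NE y : #|N y| = #|[pred x | E (fcons x y)]|.
  by apply: eq_card => x; rewrite inE.
case: (pselect (exists2 y, thick (2 * C) [pred x | E (fcons x y)] &
  D * #|[pred f : {ffun 'I_k -> I} | miss f && [forall a, f a \in N y]]| <= #|N y| ^ k)).
  move=> [y dy Ny]; exists (N y); split=> //.
  by move: dy; rewrite /thick -NE => /leq_trans; apply; rewrite leq_mul2r leq_addr orbT.
move=> none.
have dP : thick C2 [pred u : {ffun 'I_m -> I} * {ffun 'I_k -> I} |
    miss u.2 && [forall a, u.2 a \in N u.1]].
  apply: (thick_pairs (E := fun y (f : {ffun 'I_k -> I}) => miss f && [forall a, f a \in N y])).
  apply: thick_sub dH => // y /= dy; rewrite /thick card_ffun card_ord.
  have lt : #|N y| ^ k < D * #|[pred f : {ffun 'I_k -> I} | miss f && [forall a, f a \in N y]]|.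
    by rewrite ltnNge; apply/negP => le; apply: none; exists y.
  apply: (@leq_trans ((2 * C) ^ k * #|N y| ^ k)).
    rewrite -expnMn NE; have [->|k0] := posnP k; first by rewrite !expn0.
    by rewrite leq_exp2r.
  by rewrite -mulnA leq_mul2l (ltnW lt) orbT.
move: dP; rewrite (thick_swap _ (fun (y : {ffun 'I_m -> I}) (f : {ffun 'I_k -> I}) =>
  miss f && [forall a, f a \in N y])).
move/(thick_fibers (E := fun (f : {ffun 'I_k -> I}) (y : {ffun 'I_m -> I}) =>
  miss f && [forall a, f a \in N y]) (Im m)) => /(thick_witness (Im k)) [f /= df].
have [y /andP[mf _]] := thick_witness (Im m) df.
have [||N' [N1 N2]] := hC' I (fun y => [forall a, f a \in N y]) miss I0.
- by apply: thick_sub df => // z /andP[].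
- move=> f' mf'.
  have [i|c nE] := col (fun j => oapp f' f (unlift ord0 j)).
    by case: unliftP => [j _|_] /=.
  exists (fun i => c (lift ord0 i)); apply/negP => /forallP/(_ (c ord0)).
  rewrite inE => Ec; move/negP: nE; apply; move: Ec; congr (is_true (E _)).
  apply/ffunP => j; rewrite !ffunE.
  by case: unliftP => [i ->|->]; rewrite /= ?ffunE.
exists N'; split=> //.
by apply: leq_trans N1 _; rewrite leq_mul2r leq_addl orbT.
Qed.

(** Greedy choice of disjoint missing tuples; what is left is a clique. *)
Lemma disjoint_missing I m (miss : pred {ffun 'I_m -> I}) (N : {set I}) : 0 < m ->
  exists s (f : 'I_s -> {ffun 'I_m -> I}) (W : {set I}),
  [/\ forall i, miss (f i) /\ forall a, f i a \in N,
      forall i j a b, f i a = f j b -> i = j,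
      W \subset N,
      forall g : {ffun 'I_m -> I}, (forall a, g a \in W) -> ~~ miss g
    & #|N| <= #|W| + m * s].
Proof.
move=> m0; have [n] := ubnP #|N|; elim: n N => // n IH N ltn.
case: (pselect (exists2 g : {ffun 'I_m -> I}, miss g & forall a, g a \in N)); last first.
  move=> none.
  have f0 : 'I_0 -> {ffun 'I_m -> I} by case.
  exists 0, f0, N; split=> //; try by case.
    by move=> g gN; apply/negP => mg; apply: none; exists g.
  by rewrite muln0 addn0.
move=> [g mg gN]; pose S := [set g a | a : 'I_m].
have SN : S \subset N by apply/fintype.subsetP => _ /imsetP[a _ ->].
have Sm : #|S| <= m by rewrite -[leqRHS]card_ord; apply: leq_imset_card.
have S0 : 0 < #|S|.
  by apply/card_gt0P; exists (g (Ordinal m0)); apply: imset_f.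
have NS : #|N| = #|S| + #|N :\: S|.
  by rewrite -(cardsID S N) (finset.setIidPr SN).
have [|s [f [W [f1 f2 WN Wm cW]]]] := IH (N :\: S); first by lia.
have gS a : g a \in S by apply: imset_f.
have fN i a : f i a \in N /\ f i a \notin S.
  by have [_ /(_ a)] := f1 i; rewrite inE => /andP[].
exists s.+1, (fun i => oapp f g (unlift ord0 i)), W; split=> //.
- move=> i; case: unliftP => [j _|_] /=; last by [].
  by split; [case: (f1 j)|move=> a; case: (fN j a)].
- move=> i j a b; case: (unliftP ord0 i) => [i' ->|->]; case: (unliftP ord0 j) => [j' ->|->] //=.
  + by move/f2 <-.
  + by move=> e; case: (fN i' a) => _; rewrite e gS.
  + by move=> e; case: (fN j' b) => _; rewrite -e gS.
- exact: fintype.subset_trans WN (finset.subsetDl _ _).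
- by rewrite mulnS; lia.
Qed.

(** On a set N where missing tuples have density at most 1/(2m)^m, choose s disjoint missing
    tuples greedily. Any sequence of m of them has a missing transversal, and distinct sequences
    have distinct ones, so there are at least s^m missing tuples in N. Hence ms is at most |N|/2
    and the rest of N is a clique. *)
Theorem thick_clique m C : 0 < m -> exists C', forall I (E : pred {ffun 'I_m -> I}),
  0 < #|I| -> thick C E ->
  (forall f : 'I_m -> {ffun 'I_m -> I}, (forall i, ~~ E (f i)) ->
    exists c : 'I_m -> 'I_m, ~~ E [ffun i => f i (c i)]) ->
  exists W : {set I}, #|I| <= C' * #|W| /\
    forall g : {ffun 'I_m -> I}, (forall a, g a \in W) -> E g.
Proof.
move=> m0; have [C' hC'] := few_missing_on_large_subset m ((2 * m) ^ m) m C.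
exists (2 * C') => I E I0 tE col.
have [N [IN missN]] := hC' I E (fun g => ~~ E g) I0 tE col.
have [s [f [W [f1 f2 WN WE NW]]]] := disjoint_missing (fun g => ~~ E g) N m0.
exists W; split; last by move=> g /WE; rewrite negbK.
have [small|big] := leqP #|N| (2 * #|W|); first by nia.
have /choice[c hc] (j : {ffun 'I_m -> 'I_s}) :
    exists c : {ffun 'I_m -> 'I_m}, ~~ E [ffun i => f (j i) (c i)].
  have [|c nE] := col (fun i => f (j i)); first by move=> i; case: (f1 (j i)).
  exists [ffun i => c i]; apply: contra nE; congr (is_true (E _)).
  by apply/ffunP => i; rewrite !ffunE.
(* The missing transversals h j are distinct because the chosen tuples have disjoint ranges. *)
have many : s ^ m <= #|[pred g : {ffun 'I_m -> I} | ~~ E g && [forall a, g a \in N]]|.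
  pose h (j : {ffun 'I_m -> 'I_s}) : {ffun 'I_m -> I} := [ffun i => f (j i) (c j i)].
  have hI : injective h.
    move=> j j' /ffunP e; apply/ffunP => i; have := e i.
    by rewrite !ffunE; apply: f2.
  rewrite -[X in X ^ m]card_ord -[X in _ ^ X]card_ord -card_ffun -cardsT.
  rewrite -(card_imset _ hI); apply: subset_leq_card.
  apply/fintype.subsetP => _ /imsetP[j _ ->]; rewrite !inE hc /=.
  by apply/forallP => a; rewrite ffunE; case: (f1 (j a)).
have : #|N| ^ m < (2 * m * s) ^ m by rewrite ltn_exp2r //; lia.
rewrite expnMn ltnNge => /negP[]; apply: leq_trans missN.
by rewrite leq_mul2l many orbT.
Qed.

End Cliques.

(** * Blow-ups of dense hypergraphs *)
Section BlowUp.
Local Open Scope nat_scope.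
Implicit Types (I J K L : finType).

Lemma ffun_curry_bij I J K :
  bijective (fun g : {ffun K -> {ffun J -> I}} => [ffun u : K * J => g u.1 u.2]).
Proof.
exists (fun f : {ffun K * J -> I} => [ffun k => [ffun a => f (k, a)]]).
  by move=> g; apply/ffunP => k; apply/ffunP => a; rewrite !ffunE.
by move=> f; apply/ffunP => -[k a]; rewrite !ffunE.
Qed.

Lemma ffun_sum_bij I J K : bijective (fun u : {ffun J -> I} * {ffun K -> I} =>
  [ffun s : J + K => match s return I with inl a => u.1 a | inr b => u.2 b end]).
Proof.
exists (fun f : {ffun J + K -> I} => ([ffun a => f (inl a)], [ffun b => f (inr b)])).
  by move=> [g h]; congr (_, _); apply/ffunP => a; rewrite !ffunE.
by move=> f; apply/ffunP => -[a|b]; rewrite !ffunE.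
Qed.

(** Erdos's theorem that a dense m-uniform hypergraph contains a positive density of complete
    m-partite ones, proved by blowing up one coordinate after the other. *)
Lemma thick_partite L m C : exists C', forall I (E : pred {ffun 'I_m -> I}), 0 < #|I| ->
  thick C E -> thick C' [pred g : {ffun 'I_m -> {ffun L -> I}} |
    [forall s : {ffun 'I_m -> L}, E [ffun j => g j (s j)]]].
Proof.
elim: m C => [|m IH] C.
  exists 1 => I E I0 tE; have [|g Eg] := thick_witness _ tE.
    by rewrite card_ffun expn_gt0 I0.
  rewrite /thick mul1n; apply: subset_leq_card; apply/fintype.subsetP => h _.
  rewrite inE /=; apply/forallP => s; move: Eg; congr (is_true (E _)).
  by apply/ffunP => -[].
have [C' hC'] := IH (2 * C).
pose C1 := 2 * C * C'; exists (2 * C1 * (2 * C1) ^ #|L|) => I E I0 tE.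
have Im : 0 < #|{ffun 'I_m -> I}| by rewrite card_ffun expn_gt0 I0.
pose E1 (x : I) (y : {ffun 'I_m -> I}) := E (fcons x y).
have {}tE : thick (2 * C) [pred x | thick (2 * C) (E1 x)].
  by apply: thick_fibers => //; rewrite (thick_comp_bij _ _ (fcons_bij I m)).
pose E2 (x : I) (y : {ffun 'I_m -> {ffun L -> I}}) :=
  [forall s : {ffun 'I_m -> L}, E1 x [ffun j => y j (s j)]].
have {tE} : thick C1 [pred u : _ * _ | E2 u.1 u.2].
  by apply: thick_pairs; apply: thick_sub tE => // x /hC'; apply.
rewrite thick_swap => /(thick_blow_up (E := fun y x => E2 x y) L I0).
rewrite (thick_swap _ (fun y (x : {ffun L -> I}) => [forall a, E2 (x a) y])).
rewrite -(thick_comp_bij _ _ (fcons_bij _ m)); apply: thick_sub => // -[x y] /=.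
move/forallP => h; apply/forallP => s.
have /forallP/(_ [ffun j => s (lift ord0 j)]) := h (s ord0).
congr (is_true (E _)); apply/ffunP => j; rewrite !ffunE.
by case: unliftP => [i ->|->]; rewrite /= ?ffunE.
Qed.

End BlowUp.

(** * Radon, Tverberg, Helly and fractional Helly *)
Section Convexity.
Local Open Scope nat_scope.
Variable T : Type.
Implicit Types (G : set (set T)) (I J K L : finType).

Definition intersects (K : Type) (B : K -> set T) : Prop := exists z, forall k, B k z.

Definition intersectsb I (A : I -> set T) L : pred {ffun L -> I} :=
  [pred g : {ffun L -> I} | `[< intersects (fun a => A (g a)) >]].

Lemma intersectsP I (A : I -> set T) L (g : {ffun L -> I}) :
  reflect (intersects (fun a => A (g a))) (intersectsb A g).
Proof. exact: asboolP. Qed.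

Definition in_hull G (S : set T) (z : T) : Prop :=
  forall Y, G Y -> (S `<=` Y)%classic -> Y z.

(** A strong form of having Radon number at most five: the two parts are pairs. *)
Definition radon G : Prop := forall x : nat -> T, exists a b c d,
  [/\ all (fun i => i < 5) [:: a; b; c; d], uniq [:: a; b; c; d]
    & exists z, in_hull G [set x a; x b]%classic z /\ in_hull G [set x c; x d]%classic z].

Definition tverberg G J K : Prop := forall x : J -> T, exists (kappa : J -> K) (z : T),
  forall k, in_hull G [set x a | a in [set a | kappa a = k]]%classic z.

Lemma radon_tverberg G : radon G -> tverberg G 'I_5 bool.
Proof.
move=> rG x; have [a [b [c [d [/and5P[a5 b5 c5 d5 _] u [z [zab zcd]]]]]]] :=
  rG (fun n => x (inord n)).
exists (fun i => (i == inord a) || (i == inord b)), z => -[] Y GY SY.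
  apply: zab => // _ [->|->]; apply: SY.
    by exists (inord a) => //=; rewrite eqxx.
  by exists (inord b) => //=; rewrite eqxx orbT.
have neq i j : i < 5 -> j < 5 -> i != j -> (inord i == inord j :> 'I_5) = false.
  by move=> i5 j5 ij; apply/negP => /eqP/(congr1 val); rewrite /= !inordK // => /eqP; apply/negP.
move: u; rewrite /= !inE !negb_or -!andbA => /and5P[ab ac ad bc /and3P[bd cd _]].
apply: zcd => // _ [->|->]; apply: SY.
  by exists (inord c) => //=; rewrite !neq // eq_sym.
by exists (inord d) => //=; rewrite !neq // eq_sym.
Qed.

(** Partition each row, then partition the resulting Tverberg points of the rows. *)
Lemma tverberg_prod G J J' K K' : tverberg G J K -> tverberg G J' K' ->
  tverberg G (J * J')%type (K * K')%type.
Proof.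
move=> tJ tJ' x.
have /choice[f hf] (a' : J') : exists kz : (J -> K) * T,
    forall k, in_hull G [set x (a, a') | a in [set a | kz.1 a = k]]%classic kz.2.
  by have [kappa [z hz]] := tJ (fun a => x (a, a')); exists (kappa, z).
have [kappa' [w hw]] := tJ' (fun a' => (f a').2).
exists (fun u => ((f u.2).1 u.1, kappa' u.2)), w => -[k k'] Y GY SY.
apply: (hw k') => // _ [a' /= ka' <-]; apply: (hf a' k) => // _ [a /= ka <-].
by apply: SY; exists (a, a') => //=; rewrite ka ka'.
Qed.

Lemma tverberg_many n : exists J K, n < #|K| /\ forall G, radon G -> tverberg G J K.
Proof.
elim: n => [|n [J [K [nK tJK]]]].
  exists ('I_5 : finType), (bool : finType); rewrite card_bool; split=> // G.
  exact: radon_tverberg.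
exists ('I_5 * J)%type, (bool * K)%type; split; first by rewrite card_prod card_bool; lia.
by move=> G rG; apply: tverberg_prod; [apply: radon_tverberg|apply: tJK].
Qed.

(** Radon's proof, by induction on the number of sets: given five of the sets, let x a be a point
    of all sets except the a-th of them. Each set contains one of the two Radon pairs of these
    five points, hence the Radon point. *)
Lemma helly G I (A : I -> set T) K (W : {set I}) : radon G -> (forall i, G (A i)) ->
  4 <= #|K| -> 0 < #|W| ->
  (forall g : K -> I, (forall k, g k \in W) -> intersects (fun k => A (g k))) ->
  exists z, forall i, i \in W -> A i z.
Proof.
move=> rG GA K4; have [n] := ubnP #|W|; elim: n W => // n IH W ltn W0 hW.
have /card_gt0P[i0 Wi0] := W0.
have [W4|W5] := leqP #|W| 4.
  pose g (k : K) := nth i0 (enum W) (enum_rank k).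
  have [k|z hz] := hW g.
    rewrite /g; have [lt|ge] := ltnP (enum_rank k) (size (enum W)).
      by rewrite -mem_enum mem_nth.
    by rewrite nth_default.
  exists z => i Wi; have iW : index i (enum W) < #|K|.
    by apply: leq_trans K4; apply: leq_trans W4; rewrite cardE index_mem mem_enum.
  have := hz (enum_val (Ordinal iW)).
  by rewrite /g enum_valK /= nth_index ?mem_enum.
(* Five distinct members of W, and x i a common point of all members except w i. *)
pose w n := nth i0 (enum W) n.
have wW i : i < 5 -> w i \in W.
  by move=> i5; rewrite -mem_enum mem_nth // -cardE; lia.
have w_inj i j : i < 5 -> j < 5 -> i != j -> w i != w j.
  by move=> i5 j5; rewrite nth_uniq ?enum_uniq // -cardE; lia.
have /choice[x hx] (i : nat) : exists z, i < 5 -> forall j, j \in W -> j != w i -> A j z.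
  have [i5|i5] := ltnP i 5; last first.
    have [//|z _] := hW (fun=> i0); by exists z.
  have cW : #|W :\ w i| = #|W|.-1 by rewrite (cardsD1 (w i) W) wW.
  have [|||z hz] := IH (W :\ w i).
  - by rewrite cW; lia.
  - by rewrite cW; lia.
  - by move=> g gW; apply: hW => k; have := gW k; rewrite in_setD1 => /andP[].
  - by exists z => _ j Wj jw; apply: hz; rewrite in_setD1 jw.
have [a [b [c [d [/and5P[a5 b5 c5 d5 _] u [z [zab zcd]]]]]]] := rG x.
move: u; rewrite /= !inE !negb_or -!andbA => /and5P[ab ac ad bc /and3P[bd cd _]].
exists z => j Wj.
have [ja|ja] := eqVneq j (w a).
  by apply: zcd => // _ [->|->]; apply: hx => //; rewrite ja; apply: w_inj.
have [jb|jb] := eqVneq j (w b).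
  by apply: zcd => // _ [->|->]; apply: hx => //; rewrite jb; apply: w_inj.
by apply: zab => // _ [->|->]; apply: hx.
Qed.

(** There is one colour for each way kappa to divide the points of a Tverberg system J into four
    parts. If no colour class intersects, Helly provides in each class four sets without a common
    point. Assign to a point a of J a common point of the transversal that takes, in the class of
    each kappa, the set with number kappa(a) among these four. The Tverberg partition of the
    points so obtained is some kappa, and then the Tverberg point lies in all four sets of the
    class of kappa. *)
Theorem colourful_helly : exists2 m, 4 <= m &
  forall G I (A : I -> set T), radon G -> (forall i, G (A i)) ->
  forall f : 'I_m -> {ffun 'I_m -> I}, (forall i, ~~ intersectsb A (f i)) ->
  exists c : 'I_m -> 'I_m, ~~ intersectsb A [ffun i => f i (c i)].
Proof.
have [J [K [K4 tv]]] := tverberg_many 3.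
pose N := #|{ffun J -> K}|; exists (N + 4); first exact: leq_addl.
move=> G I A rG GA f hf.
pose colour (kappa : {ffun J -> K}) : 'I_(N + 4) := lshift 4 (enum_rank kappa).
have colour_inj : injective colour by move=> k k' /lshift_inj /enum_rank_inj.
have /choice[g hg] i : exists g : K -> 'I_(N + 4), ~ intersects (fun k => A (f i (g k))).
  apply: contrapT => none; move/intersectsP: (hf i); apply.
  have [|||g _|z hz] := @helly G 'I_(N + 4) (fun j => A (f i j)) K [set: 'I_(N + 4)]%SET rG.
  - by move=> j; apply: GA.
  - by [].
  - by apply/card_gt0P; exists (rshift N ord0).
  - by apply: contrapT => ng; apply: none; exists g.
  by exists z => j; apply: hz; rewrite inE.
have /card_gt0P[k0 _] : 0 < #|K| by lia.
(* Four of the colours belong to no partition; they only serve to make m at least 4. *)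
pose kap i := odflt [ffun=> k0] [pick kappa | colour kappa == i].
have kapK kappa : kap (colour kappa) = kappa.
  by rewrite /kap; case: pickP => [k /eqP/colour_inj//|/(_ kappa)/eqP].
apply: contrapT => all_meet.
have /choice[x hx] (a : J) : exists z, forall i, A (f i (g i (kap i a))) z.
  have : intersectsb A [ffun i => f i (g i (kap i a))].
    by apply/negPn/negP => nm; apply: all_meet; exists (fun i => g i (kap i a)).
  by move/intersectsP => [z hz]; exists z => i; have := hz i; rewrite ffunE.
have [kappa [z hz]] := tv G rG x.
apply: (hg (colour [ffun a => kappa a])); exists z => k.
apply: (hz k) => // _ [a /= ka <-].
by have := hx a (colour [ffun a => kappa a]); rewrite kapK ffunE ka.
Qed.

(** The clique found by [thick_clique] intersects by Helly, since m is at least 4. *)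
Theorem fractional_helly_large : exists m, forall C, exists C',
  forall G I (A : I -> set T), radon G -> 0 < #|I| -> (forall i, G (A i)) ->
  thick C (intersectsb A (L := 'I_m)) ->
  exists z, #|I| <= C' * #|[pred i | `[< A i z >]]|.
Proof.
have [m m4 ch] := colourful_helly; exists m => C.
have [|C' hC'] := @thick_clique m C; first by lia.
exists C' => G I A rG I0 GA tA.
have [W [IW Wintersects]] := hC' I (intersectsb A (L := 'I_m)) I0 tA (ch G I A rG GA).
have W0 : 0 < #|W| by nia.
have [|g gW|z hz] := helly rG GA _ W0 (K := 'I_m).
- by rewrite card_ord.
- have /intersectsP[z hz] : intersectsb A [ffun a => g a] by apply: Wintersects => a; rewrite ffunE.
  by exists z => a; have := hz a; rewrite ffunE.
exists z; apply: leq_trans IW _; rewrite leq_mul2l; apply/orP; right.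
by apply: subset_leq_card; apply/fintype.subsetP => i Wi; apply/asboolP/hz.
Qed.

Lemma thick_intersectsb_inj I (A : I -> set T) L L' C (h : L' -> L) : 0 < #|I| -> injective h ->
  thick C (intersectsb A (L := L)) -> thick C (intersectsb A (L := L')).
Proof.
move=> I0 hI tA; rewrite -(thick_ffun_comp C (intersectsb A (L := L')) I0 hI).
apply: thick_sub tA => // g /intersectsP[z hz]; apply/intersectsP; exists z => a.
by rewrite ffunE.
Qed.

(** This property, which fails for convex sets in space, is what makes three the fractional Helly
    number of the plane. *)
Definition quadruple_among_fifteen G : Prop := forall V : 'I_3 * 'I_5 -> set T,
  (forall u, G (V u)) -> (forall s : 'I_3 -> 'I_5, intersects (fun j => V (j, s j))) ->
  exists2 h : 'I_4 -> 'I_3 * 'I_5, injective h & intersects (fun a => V (h a)).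

(** Averaging: some fixed choice of positions is good for a positive proportion of the tuples. *)
Lemma thick_intersectsb_pick I (A : I -> set T) L L' C (E : pred {ffun L -> I}) :
  0 < #|I| -> thick C E ->
  (forall V, E V -> exists2 h : L' -> L, injective h & intersects (fun a => A (V (h a)))) ->
  thick (C * #|{ffun L' -> L}|) (intersectsb A (L := L')).
Proof.
move=> I0 tE pick.
pose P (V : {ffun L -> I}) (h : {ffun L' -> L}) :=
  injectiveb h && intersectsb A [ffun a => V (h a)].
have V0 : 0 < #|{ffun L -> I}| by rewrite card_ffun expn_gt0 I0.
have [V EV|h th] := thick_pigeonhole (P := P) V0 tE.
  have [h hI [z hz]] := pick V EV.
  exists [ffun a => h a]; apply/andP; split.
    by apply/injectiveP => a b; rewrite !ffunE; apply: hI.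
  by apply/intersectsP; exists z => a; rewrite !ffunE.
have [V /andP[/injectiveP hI _]] := thick_witness V0 th.
by rewrite -(thick_ffun_comp _ _ I0 hI); apply: thick_sub th => // V' /andP[].
Qed.

Lemma thick_triples_quadruples C : exists C', forall G I (A : I -> set T),
  quadruple_among_fifteen G -> 0 < #|I| -> (forall i, G (A i)) ->
  thick C (intersectsb A (L := 'I_3)) -> thick C' (intersectsb A (L := 'I_4)).
Proof.
have [C1 hC1] := thick_partite 'I_5 3 C.
exists (C1 * #|{ffun 'I_4 -> 'I_3 * 'I_5}|) => G I A fifteen I0 GA /(hC1 _ _ I0) tA.
pose E (V : {ffun 'I_3 * 'I_5 -> I}) :=
  [forall s : {ffun 'I_3 -> 'I_5}, intersectsb A [ffun j => V (j, s j)]].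
have {}tA : thick C1 E.
  rewrite -(thick_comp_bij _ _ (ffun_curry_bij I 'I_5 'I_3)).
  apply: thick_sub tA => // g /forallP h; apply/forallP => s.
  by have := h s; congr (is_true (intersectsb A _)); apply/ffunP => j; rewrite !ffunE.
apply: thick_intersectsb_pick I0 tA _ => V /forallP EV.
apply: (fifteen (fun u => A (V u))) => [u|s]; first exact: GA.
have /intersectsP[z hz] := EV [ffun j => s j]; exists z => j.
by have := hz j; rewrite !ffunE.
Qed.

Definition closed_bigcap G : Prop := forall (K : Type) (k0 : K) (B : K -> set T),
  (forall k, G (B k)) -> G (\bigcap_k B k)%classic.

(** For fixed y the sets A i intersected with all A (y b) belong to G again, so the step from
    triples to quadruples applies to them; for a positive density of the tuples y their triples
    are dense. *)
Lemma thick_triples_tuples C n : exists C', forall G I (A : I -> set T),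
  quadruple_among_fifteen G -> closed_bigcap G -> 0 < #|I| -> (forall i, G (A i)) ->
  thick C (intersectsb A (L := 'I_3)) -> thick C' (intersectsb A (L := ('I_3 + 'I_n)%type)).
Proof.
elim: n => [|n [C1 hC1]].
  exists C => G I A _ _ I0 GA.
  apply: (thick_intersectsb_inj (h := fun s : 'I_3 + 'I_0 =>
    match s with inl a => a | inr b => widen_ord (leq0n 3) b end)) => //.
  by move=> [a|[]//] [b|[]//] /= ->.
have [C2 hC2] := thick_triples_quadruples (2 * C1).
exists (2 * C1 * C2) => G I A fifteen Gcap I0 GA /(hC1 _ _ _ fifteen Gcap I0 GA).
have I3 : 0 < #|{ffun 'I_3 -> I}| by rewrite card_ffun expn_gt0 I0.
pose B (y : {ffun 'I_n -> I}) i := (\bigcap_(o : option 'I_n) A (oapp y i o))%classic.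
pose join k (u : {ffun 'I_k -> I} * {ffun 'I_n -> I}) : {ffun 'I_k + 'I_n -> I} :=
  [ffun s => match s return I with inl a => u.1 a | inr b => u.2 b end].
have joinE k x y : 0 < k -> intersectsb (B y) x = intersectsb A (@join k (x, y)).
  move=> k0; apply/intersectsP/intersectsP => -[z hz]; exists z.
    move=> [a|b]; rewrite ffunE /=; first by have := hz a None Logic.I.
    by have := hz (Ordinal k0) (Some b) Logic.I.
  move=> a [b|] _ /=; first by have := hz (inr b); rewrite ffunE.
  by have := hz (inl a); rewrite ffunE.
rewrite -(thick_comp_bij _ _ (ffun_sum_bij I 'I_3 'I_n)) => tA.
have {}tA : thick (2 * C1) [pred y | thick (2 * C1) (intersectsb (B y) (L := 'I_3))].
  apply: (thick_fibers (E := fun y (x : {ffun 'I_3 -> I}) => intersectsb (B y) x) I3).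
  rewrite (thick_swap _ (fun y (x : {ffun 'I_3 -> I}) => intersectsb (B y) x)).
  by apply: thick_sub tA => // -[x y] /=; rewrite joinE.
have {}tA : thick (2 * C1 * C2) (intersectsb A (L := ('I_4 + 'I_n)%type)).
  rewrite -(thick_comp_bij _ _ (ffun_sum_bij I 'I_4 'I_n)).
  have : thick (2 * C1 * C2) [pred u : _ * {ffun 'I_4 -> I} | intersectsb (B u.1) u.2].
    apply: (thick_pairs (E := fun y (x : {ffun 'I_4 -> I}) => intersectsb (B y) x)).
    apply: thick_sub tA => // y /=; apply: (hC2 G) => // i.
    by apply: (Gcap _ None) => o; apply: GA.
  rewrite (thick_swap _ (fun y (x : {ffun 'I_4 -> I}) => intersectsb (B y) x)).
  by apply: thick_sub => // -[x y] /=; rewrite joinE.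
apply: (thick_intersectsb_inj (h := fun s : 'I_3 + 'I_n.+1 => match s with
  | inl a => inl (widen_ord (leqnSn 3) a)
  | inr b => oapp inr (inl ord_max) (unlift ord0 b) end)) tA => //.
move=> [a|b] [a'|b'] /=.
- by move=> [/val_inj->].
- case: unliftP => [//|_ /= [e]]; by have := ltn_ord a; rewrite e.
- case: unliftP => [//|_ /= [e]]; by have := ltn_ord a'; rewrite -e.
case: (unliftP ord0 b) => [j ->|->]; case: (unliftP ord0 b') => [j' ->|->] //=.
by move=> [->].
Qed.

Theorem fractional_helly C : exists C', forall G I (A : I -> set T),
  radon G -> quadruple_among_fifteen G -> closed_bigcap G -> 0 < #|I| -> (forall i, G (A i)) ->
  thick C (intersectsb A (L := 'I_3)) ->
  exists z, #|I| <= C' * #|[pred i | `[< A i z >]]|.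
Proof.
have [m hm] := fractional_helly_large.
have [C1 hC1] := thick_triples_tuples C m; have [C' hC'] := hm C1.
exists C' => G I A rG fifteen Gcap I0 GA /(hC1 _ _ _ fifteen Gcap I0 GA) tA.
apply: (hC' G) => //.
apply: thick_intersectsb_inj tA => //.
by move=> a b; exact: (@inr_inj 'I_3 'I_m a b).
Qed.

End Convexity.

(** * Multiplicative weights *)
Section FractionalCover.
Local Open Scope nat_scope.
Variable T : Type.
Implicit Types (I J Q : finType).

Lemma bernoulli2 a : 0 < a -> 2 * a ^ a <= a.+1 ^ a.
Proof.
move=> a0; suff h k : a ^ k * (a + k) <= a * a.+1 ^ k.
  rewrite -(leq_pmul2l a0) (_ : a * (2 * a ^ a) = a ^ a * (a + a)) ?h //.
  by rewrite addnn -mul2n mulnCA (mulnC a) mulnCA.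
elim: k => [|k IH]; first by rewrite addn0 !expn0 mul1n muln1.
rewrite !expnS; nia.
Qed.

(** A weighting by natural numbers is modelled by an index type with repetitions. *)
Lemma card_weighted I (w : I -> nat) (P : pred I) :
  #|[pred j : {i : I & 'I_(w i)} | P (tag j)]| = \sum_(i | P i) w i.
Proof.
rewrite -sum1_card.
rewrite (eq_bigr (fun i => \sum_(j : 'I_(w i)) 1)); last first.
  by move=> i _; rewrite sum1_card card_ord.
rewrite (@sig_big_dep _ _ _ I (fun i => 'I_(w i)) P (fun _ => xpredT) (fun _ _ => 1)).
by apply: eq_bigl => j; rewrite andbT.
Qed.

(** Half of linear programming duality. Start with weight 1 for each set and repeatedly take a
    point in a proportion 1/D of the total weight, doubling the weight of the sets it misses. The
    total weight grows at most by a factor (2D-1)/D in each step, instead of 2, so a set that is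
    missed too often would outweigh the total. *)
Lemma fractional_cover D : exists c, forall I (B : I -> set T),
  0 < #|I| ->
  (forall J (e : J -> I), 0 < #|J| ->
     exists z, #|J| <= D * #|[pred j | `[< B (e j) z >]]|) ->
  exists (Q : finType) (x : Q -> T), 0 < #|Q| /\
    forall i, #|Q| <= c * #|[pred q | `[< B i (x q) >]]|.
Proof.
pose a := 2 * D - 1; exists (2 * a) => I B I0 heavy.
have D0 : 0 < D.
  by have [z] := heavy I id I0; case: (D) => // ; rewrite mul0n leqNgt I0.
pose hit i : pred T := fun z => `[< B i z >].
have [s ss sw] : exists2 s : seq T, size s = 2 * a * #|I| &
    D ^ (size s) * \sum_i 2 ^ count (predC (hit i)) s <= a ^ (size s) * #|I|.
  elim: (2 * a * #|I|) => [|t [s ss sw]].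
    by exists [::]; rewrite //= sum1_card !expn0 !mul1n.
  pose w i := 2 ^ count (predC (hit i)) s; pose W := \sum_i w i.
  have cardW : #|{: {i : I & 'I_(w i)}}| = W.
    by rewrite /W -(card_weighted w xpredT); apply: eq_card.
  have W0 : 0 < #|{: {i : I & 'I_(w i)}}|.
    have /card_gt0P[i _] := I0.
    by rewrite cardW /W (bigD1 i) //= addn_gt0 /w expn_gt0.
  have [z hz] := heavy _ (fun j : {i : I & 'I_(w i)} => tag j) W0.
  exists (z :: s); rewrite /= ?ss //.
  set W' := \sum_i _; pose H := \sum_(i | hit i z) w i.
  have WH : W <= D * H by rewrite -cardW /H -card_weighted.
  have W'H : W' + H = 2 * W.
    rewrite /W /H [X in _ + X]big_mkcond big_distrr -big_split /=; apply: eq_bigr => i _.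
    by case: (hit i z); rewrite /w /= ?add0n ?add1n ?expnS ?mul2n -?addnn ?addn0.
  have le : D * W' <= a * W by rewrite /a mulnBl mul1n; nia.
  rewrite !expnS [D * _]mulnC -!mulnA; apply: leq_trans (leq_mul (leqnn _) le) _.
  by rewrite mulnCA leq_mul2l; move: sw; rewrite ss => ->; rewrite orbT.
pose Q := 'I_(size s); exists Q, (tnth (in_tuple s)).
have a0 : 0 < a by rewrite /a; lia.
split; first by rewrite card_ord ss !muln_gt0 a0 I0.
move=> i; have -> : #|[pred q : Q | `[< B i (tnth (in_tuple s) q) >]]| = count (hit i) s.
  by rewrite -sum1_card -sum1_count [RHS]big_tnth; apply: eq_bigl => q; rewrite inE.
rewrite card_ord ss leq_pmul2l; last by rewrite muln_gt0 a0.
have D2 : a.+1 = 2 * D by rewrite /a; lia.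
set n := #|I|; set h := count _ _.
have hs : h + count (predC (hit i)) s = size s by rewrite count_predC.
have wi : D ^ size s * 2 ^ count (predC (hit i)) s <= a ^ size s * n.
  apply: leq_trans sw; rewrite leq_mul2l (bigD1 i) //=.
  by rewrite leq_addr orbT.
(* Two rounds of a steps outweigh a factor 4, so 2a|I| steps gain 4^|I|, which absorbs the
   initial total weight |I|, itself at most 2^|I|. *)
have b : 4 ^ n * a ^ size s <= a.+1 ^ size s.
  rewrite ss ![_ ^ (_ * n)]expnM -expnMn.
  have [->|n0] := posnP n; first by rewrite !expn0.
  rewrite leq_exp2r // -[4]/(2 ^ 2) [2 * a]mulnC !expnM -expnMn leq_exp2r //.
  exact: bernoulli2.
have an : 0 < a ^ size s by rewrite expn_gt0 a0.
have : 4 ^ n <= n * 2 ^ h.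
  rewrite -(leq_pmul2l an) mulnA [leqLHS]mulnC; apply: leq_trans b _.
  by rewrite D2 expnMn -hs [2 ^ _]expnD -mulnA [leqLHS]mulnC [_ * D ^ _]mulnC leq_mul2r hs wi orbT.
have n2 : n <= 2 ^ n by apply/ltnW/ltn_expl.
rewrite -[4]/(2 * 2) expnMn => le.
rewrite -(leq_exp2l (m := 2)) // -(leq_pmul2l (m := 2 ^ n)) ?expn_gt0 //.
by apply: leq_trans le _; rewrite leq_mul2r n2 orbT.
Qed.

End FractionalCover.

(** * Weak nets *)
Section WeakNets.
Local Open Scope nat_scope.
Local Open Scope classical_set_scope.
Variable T : Type.
Implicit Types (G : set (set T)) (I J K L Q : finType).

Definition hull_of I (B : I -> set T) J (x : J -> T) : set T :=
  \bigcap_(i in [set i | forall a, B i (x a)]) B i.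

Lemma hull_of_closed G I (B : I -> set T) J (x : J -> T) i0 : closed_bigcap G ->
  (forall i, G (B i)) -> (forall a, B i0 (x a)) -> G (hull_of B x).
Proof.
move=> Gcap GB Bi0.
have -> : hull_of B x =
    \bigcap_(u in [set: {i | forall a, B i (x a)}]) B (sval u).
  apply/seteqP; split=> z hz; first by move=> [i hi] _; apply: hz.
  by move=> i hi; apply: (hz (exist _ i hi)).
by apply: Gcap => [|u]; [exists i0|apply: GB].
Qed.

(** Selection lemma inside the member B i0. By Tverberg, a positive proportion of the m-tuples of
    J-tuples of points of B i0 have intersecting hulls, where m is the size of the tuples in
    [fractional_helly_large]; so some z lies in a positive proportion of the hulls. *)
Lemma deep_point c : exists J D,
  forall G I (B : I -> set T) Q (x : Q -> T) i0, radon G -> closed_bigcap G ->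
  (forall i, G (B i)) -> 0 < #|Q| ->
  #|Q| <= c * #|[pred q | `[< B i0 (x q) >]]| ->
  exists z, #|Q| ^ #|J| <= D * #|[pred g : {ffun J -> Q} |
    `[< (forall a, B i0 (x (g a))) /\ hull_of B (fun a => x (g a)) z >]]|.
Proof.
have [m hm] := @fractional_helly_large T.
have [J [K [mK tv]]] := @tverberg_many T m.
have [C' hC'] := hm (1 * #|{ffun J -> K}|).
exists J, (c ^ #|J| * C') => G I B Q x i0 rG Gcap GB Q0 dQ.
pose P0 : pred Q := fun q => `[< B i0 (x q) >].
pose Q' := {q : Q | P0 q}.
have cQ' : #|{: Q'}| = #|[pred q | `[< B i0 (x q) >]]|.
  by rewrite card_sig; apply: eq_card.
have Q'0 : 0 < #|{: Q'}| by rewrite cQ'; nia.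
pose A (g : {ffun J -> Q'}) := hull_of B (fun a => x (val (g a))).
have F0 : 0 < #|{ffun J -> Q'}| by rewrite card_ffun expn_gt0 Q'0.
have GA g : G (A g).
  by apply: (hull_of_closed (i0 := i0) Gcap GB) => a; apply/asboolP/(valP (g a)).
have [z hz] : exists z, #|{ffun J -> Q'}| <= C' * #|[pred g | `[< A g z >]]|.
  apply: (hC' G) => //.
  pose P (y : {ffun J -> Q'}) (kappa : {ffun J -> K}) := `[< exists z,
    forall k, in_hull G [set x (val (y a)) | a in [set a | kappa a = k]] z >].
  have [||kappa] := @thick_pigeonhole _ _ 1 xpredT P F0.
  - by rewrite /thick mul1n; apply: subset_leq_card; apply/fintype.subsetP.
  - move=> y _; have [kappa [z hz]] := tv G rG (fun a => x (val (y a))).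
    exists [ffun a => kappa a]; apply/asboolP; exists z => k Y GY SY.
    by apply: (hz k) => // _ [a /= ka <-]; apply: SY; exists a; rewrite //= ffunE.
  (* A random J-tuple is obtained by choosing one J-tuple for each part independently and reading
     its entry a in the tuple of the part of a. *)
  pose h (a : J) : K * J := (kappa a, a).
  have hI : injective h by move=> a b [].
  rewrite -(thick_ffun_comp _ (P^~ kappa) Q'0 hI).
  rewrite -(thick_comp_bij _ _ (ffun_curry_bij _ J K)) => tK.
  have {tK} : thick (1 * #|{ffun J -> K}|) (intersectsb A (L := K)).
    apply: thick_sub tK => // g /asboolP[z hz]; apply/asboolP; exists z => k i hi.
    apply: (hz k) => // _ [a /= ka <-].
    by rewrite !ffunE /= ka; apply: hi.
  have wI : injective (fun a : 'I_m => enum_val (widen_ord (ltnW mK) a) : K).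
    by move=> a b /enum_val_inj /(congr1 val) /= /val_inj.
  exact: thick_intersectsb_inj wI.
exists z.
have : #|Q| ^ #|J| <= c ^ #|J| * #|{ffun J -> Q'}|.
  rewrite card_ffun -expnMn cQ'.
  by have [->|J0] := posnP #|J|; rewrite ?expn0 ?leq_exp2r.
move/leq_trans; apply; rewrite -mulnA leq_mul2l; apply/orP; right.
apply: leq_trans hz _; rewrite leq_mul2l; apply/orP; right.
pose v (g : {ffun J -> Q'}) : {ffun J -> Q} := [ffun a => val (g a)].
have vI : injective v.
  by move=> g g' /ffunP e; apply/ffunP => a; apply: val_inj; have := e a; rewrite !ffunE.
rewrite -(fintype.card_image vI); apply: subset_leq_card; apply/fintype.subsetP.
move=> _ /fintype.imageP[g /asboolP Agz ->]; apply/asboolP.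
have -> : (fun a => x (v g a)) = (fun a => x (val (g a))).
  by apply/funext => a; rewrite ffunE.
split=> // a; rewrite ffunE; exact/asboolP/(valP (g a)).
Qed.

(** While some member is not hit, add a point that is deep for it. Hulls of tuples inside this
    member are contained in it, so they were not hit before: a fixed proportion of all J-tuples
    is newly hit in each step, and this can happen only boundedly often. *)
Theorem weak_net c : exists N, forall G I (B : I -> set T) Q (x : Q -> T),
  radon G -> closed_bigcap G -> (forall i, G (B i)) -> 0 < #|Q| ->
  (forall i, #|Q| <= c * #|[pred q | `[< B i (x q) >]]|) ->
  exists2 s : seq T, size s <= N & forall i, has (fun z => `[< B i z >]) s.
Proof.
have [J [D deep]] := @deep_point c.
exists D.+1 => G I B Q x rG Gcap GB Q0 dQ.
pose H (g : {ffun J -> Q}) := hull_of B (fun a => x (g a)).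
pose killed s := [pred g : {ffun J -> Q} | has (fun z => `[< H g z >]) s].
have step n : exists2 s : seq T, size s <= n &
    (forall i, has (fun z => `[< B i z >]) s) \/ n * #|Q| ^ #|J| <= D * #|killed s|.
  elim: n => [|n [s sn [hit|kill]]]; first by exists [::] => //; right.
    by exists s; [apply: leqW|left].
  case: (pselect (forall i, has (fun z => `[< B i z >]) s)) => [hit|/existsNP[i0 /negP miss]].
    by exists s; [apply: leqW|left].
  have [z hz] := deep G I B Q x i0 rG Gcap GB Q0 (dQ i0).
  exists (z :: s) => //; right; rewrite mulSn addnC.
  apply: leq_trans (leq_add kill hz) _.
  rewrite -mulnDr leq_mul2l; apply/orP; right.
  set new := [pred _ | _].
  have disjoint : [predI killed s & new] =1 pred0.
    move=> g; apply/negP => /andP[/= killed_g /asboolP[gi0 _]]; move/negP: miss; apply.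
    by apply: sub_has killed_g => w /asboolP Hgw; apply/asboolP/Hgw.
  rewrite -cardUI (eq_card0 disjoint) addn0; apply: subset_leq_card.
  apply/fintype.subsetP => g /orP[/= killed_g|/asboolP[_ Hgz]].
    by apply/orP; right.
  by apply/orP; left; apply/asboolP.
have [s sD [hit|]] := step D.+1; first by exists s.
rewrite leqNgt => /negP[]; apply: (@leq_ltn_trans (D * #|Q| ^ #|J|)).
  by rewrite leq_mul2l -card_ffun max_card orbT.
by rewrite ltn_mul2r expn_gt0 Q0 ltnSn.
Qed.

End WeakNets.

(** * The plane *)
Section Plane.
Local Open Scope nat_scope.
Local Open Scope classical_set_scope.
Variable R : realType.
Local Notation point := (R * R)%type.
Variable G : set (set point).
Hypothesis G_open : forall Y, G Y -> open Y.
Hypothesis G_connected : forall Y, G Y -> connected Y.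
Hypothesis G_bigcap : closed_bigcap G.

(** Join the points i and j by the intersection of all members of G that contain both. If there
    is none for some pair, the hull condition for this pair is void. *)
Lemma plane_radon : radon G.
Proof.
move=> x.
pose S i j := [set Y | [/\ G Y, Y (x i) & Y (x j)]].
case: (pselect (forall i j, i < j < 5 -> S i j !=set0)) => [S0|none].
  have GE i j : i < j < 5 -> G (\bigcap_(Y in S i j) Y).
    move=> /S0[Y0 SY0].
    have -> : \bigcap_(Y in S i j) Y = \bigcap_(u in [set: {Y | S i j Y}]) sval u.
      apply/seteqP; split=> z hz; first by move=> [Y SY] _; apply: hz.
      by move=> Y SY; apply: (hz (exist _ Y SY)).
    by apply: G_bigcap => [|[Y []]]; first by exists Y0.
  have [|i [j [k [l [ij kl u [z [zij zkl]]]]]]] :=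
    @K5_crossing R x (fun i j => \bigcap_(Y in S i j) Y).
    move=> i j ij; split; first exact/G_open/GE.
    - exact/G_connected/GE.
    - by move=> Y [].
    - by move=> Y [].
  exists i, j, k, l; split=> //=; first by lia.
  by exists z; split=> Y GY SY; [apply: zij|apply: zkl]; split=> //; apply: SY;
    [left|right|left|right].
move/existsNP: none => [i /existsNP[j /not_implyP[ij Sij]]].
have [c [d [c5 d5 u]]] : exists c d, [/\ c < 5, d < 5 & uniq [:: i; j; c; d]].
  pose r := [seq n <- iota 0 5 | n \notin [:: i; j]].
  exists (nth 0 r 0), (nth 0 r 1); rewrite /r.
  by move: i j ij {Sij r} => [|[|[|[|[|i]]]]] [|[|[|[|[|j]]]]] // ij; exfalso; lia.
exists i, j, c, d; split=> //=; first by lia.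
exists (x c); split=> Y GY SY; last by apply: SY; left.
by case: Sij; exists Y; split=> //; apply: SY; [left|right].
Qed.

(** Write u, v and w for the three classes, and take as vertices five points x a of the
    intersections of u a, v a and w a. The edge from a to b is the chain of pairwise
    intersections of u a with v a, v a with w b, and w b with u b, where consecutive links meet.
    A point common to two independent edges lies in two sets with index a or b and in two other
    sets. *)
Lemma plane_quadruple_among_fifteen : quadruple_among_fifteen G.
Proof.
move=> V GV hV.
pose v j a := V (inord j, inord a).
have GI Y Z : G Y -> G Z -> G (Y `&` Z).
  move=> GY GZ; have -> : Y `&` Z = \bigcap_b (if b then Y else Z).
    apply/seteqP; split=> z; first by move=> [? ?] [].
    by move=> h; split; [apply: (h true)|apply: (h false)].
  by apply: (G_bigcap true) => -[].
have Gv j a : G (v j a) by apply: GV.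
have v3 a b c : exists z, [/\ v 0 a z, v 1 b z & v 2 c z].
  have [z hz] := hV (fun j => inord (nth 0 [:: a; b; c] j)).
  by exists z; split; rewrite /v; [have := hz (inord 0)|have := hz (inord 1)|have := hz (inord 2)];
    rewrite inordK.
have /choice[x hx] a := v3 a a a.
pose E a b := (v 0 a `&` v 1 a) `|` (v 1 a `&` v 2 b) `|` (v 2 b `&` v 0 b).
have E_positions a b z : a < b < 5 -> E a b z -> exists p q : 'I_3 * 'I_5,
    [/\ p != q, p.2 \in [:: inord a; inord b], q.2 \in [:: inord a; inord b] & V p z /\ V q z].
  have neq (i j : nat) (s t : 'I_5) : i < 3 -> j < 3 -> i != j ->
      (inord i, s) != (inord j, t) :> 'I_3 * 'I_5.
    by move=> i3 j3; apply: contraNneq => -[/(congr1 val)] /=; rewrite !inordK // => ->.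
  move=> ab [[]|] [h1 h2].
  - by exists (inord 0, inord a), (inord 1, inord a); split; rewrite ?neq ?inE ?eqxx.
  - by exists (inord 1, inord a), (inord 2, inord b); split; rewrite ?neq ?inE ?eqxx ?orbT.
  - by exists (inord 2, inord b), (inord 0, inord b); split; rewrite ?neq ?inE ?eqxx ?orbT.
have [|i [j [k [l [ij kl u [z [zij zkl]]]]]]] := @K5_crossing R x E.
  move=> a b ab; split.
  - by do 2?[apply: openU]; apply: G_open; apply: GI.
  - have [y [y0 y1 y2]] := v3 a a b; have [y' [y'0 y'1 y'2]] := v3 b a b.
    apply: connectedU; last by apply/G_connected/GI.
      by exists y'; split; [right|].
    by apply: connectedU; [exists y|apply/G_connected/GI|apply/G_connected/GI].
  - by have [] := hx a; left; left.
  - by have [] := hx b; right.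
have [p [q [pq p2 q2 [Vp Vq]]]] := E_positions i j z ij zij.
have [p' [q' [pq' p'2 q'2 [Vp' Vq']]]] := E_positions k l z kl zkl.
have disj s t : s \in [:: inord i; inord j] -> t \in [:: inord k; inord l] -> s != t :> 'I_5.
  have ne a b : a < 5 -> b < 5 -> a != b -> inord a != inord b :> 'I_5.
    by move=> a5 b5; apply: contraNneq => /(congr1 val) /=; rewrite !inordK // => ->.
  move: u; rewrite /= !inE !negb_or -!andbA => /and5P[_ ik il jk /and3P[jl _ _]].
  by move=> /orP[]/eqP-> /orP[]/eqP->; apply: ne => //; lia.
have disj' (s t : 'I_3 * 'I_5) :
    s.2 \in [:: inord i; inord j] -> t.2 \in [:: inord k; inord l] -> s != t.
  by move=> s2 t2; apply: contraNneq (disj _ _ s2 t2) => ->.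
exists (tnth [tuple p; q; p'; q']).
  by apply/tuple_uniqP; rewrite /= !inE !negb_or pq pq' !disj'.
exists z => -[[|[|[|[|n]]]] n4] //.
Qed.

End Plane.

(** * The (p,q) property and piercing numbers *)
Section Piercing.
Local Open Scope nat_scope.
Local Open Scope classical_set_scope.
Variable T : Type.
Implicit Types (F : set (set T)).

(** Among 2p members with repetitions, either one member occurs three times or at least p members
    are distinct. *)
Lemma pq_three_positions p q F (I : finType) (B : I -> set T) (b : 'I_(2 * p) -> I) :
  3 <= q <= p ->
  pq_property p q F -> injective B -> (forall i, F (B i)) -> (forall i, B i !=set0) ->
  exists2 h : 'I_3 -> 'I_(2 * p), injective h & intersects (fun a => B (b (h a))).
Proof.
move=> /andP[q3 qp] pqF BI FB B0.
have tuple3 (k1 k2 k3 : 'I_(2 * p)) z : k1 != k2 -> k2 != k3 -> k3 != k1 ->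
    B (b k1) z -> B (b k2) z -> B (b k3) z ->
    exists2 h : 'I_3 -> 'I_(2 * p), injective h & intersects (fun a => B (b (h a))).
  move=> k12 k23 k31 z1 z2 z3; exists (tnth [tuple k1; k2; k3]).
    by apply/tuple_uniqP; rewrite /= !inE negb_or k12 k23 (eq_sym k1) k31.
  by exists z => -[[|[|[|n]]] n3].
have [/existsP[i /card_gt2P[k1 [k2 [k3 [[/eqP b1 /eqP b2 /eqP b3] [k12 k23 k31]]]]]]|] :=
    boolP [exists i, 2 < #|[pred k | b k == i]|].
  by have [z Bz] := B0 i; apply: (tuple3 k1 k2 k3 z); rewrite ?b1 ?b2 ?b3.
rewrite negb_exists => /forallP few.
pose S := (b @: [set: 'I_(2 * p)])%SET.
have pS : p <= #|S|.
  have : \sum_(k in [set: 'I_(2 * p)]%SET) 1 <= #|S| * 2.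
    rewrite (partition_big_imset b) -sum_nat_const; apply: leq_sum => i _.
    rewrite sum1_card; have := few i; rewrite -leqNgt; apply: leq_trans.
    by apply: subset_leq_card; apply/fintype.subsetP => k /andP[].
  by rewrite sum1_card cardsT card_ord; lia.
have /card_gt0P[i0 _] : 0 < #|S| by lia.
pose f n := B (nth i0 (enum S) n).
have [||B' [B'A B'q [z hz]]] := pqF [set f n | n in `I_p].
- by move=> _ [n _ <-]; apply: FB.
- apply: inj_card_eq => n n' /set_mem /= np /set_mem /= n'p /BI /eqP.
  by rewrite nth_uniq ?enum_uniq -?cardE //; try lia; move/eqP.
have /card_esym/card_set_bijP[g [gB' gI _]] := B'q.
have /choice[k hk] n : exists k, n < q -> g n = B (b k).
  have [nq|nq] := ltnP n q; last first.
    by have /imsetP[k _ _] : nth i0 (enum S) 0 \in S;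
      [rewrite -mem_enum mem_nth // -cardE; lia|exists k].
  have [m /= mp <-] := B'A _ (gB' n nq).
  have /imsetP[k _ e] : nth i0 (enum S) m \in S by rewrite -mem_enum mem_nth // -cardE; lia.
  by exists k; rewrite /f e.
have kz n : n < q -> B (b (k n)) z by move=> nq; rewrite -hk //; apply: hz; apply: gB'.
have kneq n n' : n < q -> n' < q -> n != n' -> k n != k n'.
  move=> nq n'q; apply: contraNneq => e; apply/eqP; apply: gI; rewrite ?inE //.
  by rewrite !hk // e.
by apply: (tuple3 (k 0) (k 1) (k 2) z); (apply: kneq || apply: kz) => //; lia.
Qed.

Lemma pierceable_points F (s : seq T) :
  (forall X, F X -> has (fun z => `[< X z >]) s) -> exists2 k, k <= size s & pierceable F k.
Proof.
elim: s F => [|z s IH] F hF.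
  exists 0 => //; exists (fun=> set0) => [|i]; last by [].
  split; [|by move=> i j []|by []].
  by apply/seteqP; split=> X; [case|move/hF].
pose F1 := F `&` [set X | X z].
have [|k ks [H [Hcover Htriv H0] Hint]] := IH (F `\` F1).
  move=> X [FX nX]; have := hF X FX; rewrite /= => /orP[/asboolP Xz|//].
  by case: nX.
have [F10|/set0P F10] := eqVneq F1 set0.
  rewrite F10 setD0 in Hcover; exists k; first exact: leqW.
  by exists H.
exists k.+1 => //; exists (fun i => if i == k then F1 else H i); last first.
  move=> i /= ik; case: eqP => [_|ne]; last by apply: Hint => /=; lia.
  by exists z => X [].
split.
- apply/seteqP; split=> X.
    move=> [i /= ik]; case: eqP => [_ []//|ne HX].
    suff : (F `\` F1) X by case.
    by rewrite -Hcover; exists i => //=; lia.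
  move=> FX; have [F1X|nF1X] := pselect (F1 X); first by exists k => //=; rewrite eqxx.
  have : (F `\` F1) X by [].
  rewrite -Hcover => -[i /= ik HX]; exists i; first by rewrite /=; lia.
  by case: eqP => //; lia.
- have HF i X : i < k -> H i X -> ~ F1 X.
    move=> ik HX; suff : (F `\` F1) X by case.
    by rewrite -Hcover; exists i.
  move=> i j /= ik jk [X []]; case: eqP => [->|ni]; case: eqP => [->|nj] //.
  + by move=> F1X HX; case: (HF j X) => //; lia.
  + by move=> HX F1X; case: (HF i X) => //; lia.
  + by move=> HX HX'; apply: Htriv => /=; [lia|lia|exists X].
- move=> i /= ik; case: eqP => [_|ne]; first by [].
  by apply: H0 => /=; lia.
Qed.

Lemma piercing_number_points F (s : seq T) :
  (forall X, F X -> has (fun z => `[< X z >]) s) ->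
  exists2 k, is_piercing_number F k & k <= size s.
Proof.
move=> /pierceable_points[k ks Fk].
have ex : exists k, `[< pierceable F k >] by exists k; apply/asboolP.
have [m /asboolP Fm min] := ex_minnP ex.
exists m; first by split=> // j Fj; apply/min/asboolP.
by apply: leq_trans ks; apply/min/asboolP.
Qed.

Definition intersections F : set (set T) :=
  [set Y | exists A, [/\ A `<=` F, A !=set0 & Y = \bigcap_(X in A) X]].

(** An intersection of intersections is the intersection over the union of the subfamilies. *)
Lemma intersections_bigcap F : closed_bigcap (intersections F).
Proof.
move=> K k0 B /choice[A hA]; exists (\bigcup_k A k); split.
- by move=> X [k _]; case: (hA k) => AF _ _ /AF.
- by have [_ [X AX] _] := hA k0; exists X, k0.
apply/seteqP; split=> z hz.
  by move=> X [k _ AX]; have := hz k Logic.I; have [_ _ ->] := hA k; apply.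
by move=> k _; have [_ _ ->] := hA k => X AX; apply: hz; exists k.
Qed.

End Piercing.

Local Open Scope classical_set_scope.

Theorem theorem1p7 (R : realType) (p q : nat) (hq : (3 <= q)%N) (hpq : (q <= p)%N) :
  exists C : nat, forall F : set (set (R * R)%type),
    finite_set F ->
    (forall X : set (R * R)%type, F X -> [/\ X !=set0, open X & connected X]) ->
    (forall A : set (set (R * R)%type), A `<=` F -> A !=set0 ->
       \bigcap_(X in A) X = set0 \/ connected (\bigcap_(X in A) X)) ->
    pq_property p q F ->
    exists2 k : nat, is_piercing_number F k & (k <= C)%N.
Proof.
have [D hD] := @fractional_helly (R * R)%type (1 * #|{ffun 'I_3 -> 'I_(2 * p)}|).
have [c hc] := @fractional_cover (R * R)%type D.
have [N hN] := @weak_net (R * R)%type c.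
exists N => F finF hF hcap pqF.
have [n /card_esym/card_set_bijP[f [fF fI fS]]] := finF.
suff [s sN hs] : exists2 s : seq (R * R)%type, size s <= N &
    forall X, F X -> has (fun z => `[< X z >]) s.
  have [k Fk ks] := piercing_number_points hs.
  by exists k => //; apply: leq_trans ks sN.
case: n => [|n] in f fF fI fS *.
  by exists [::] => // X /fS[].
pose B (i : 'I_n.+1) := f i; pose G := intersections F.
have FB i : F (B i) by apply: fF => /=.
have BI : injective B.
  by move=> i j e; apply/val_inj/fI => //; rewrite inE /=.
have Gopen Y : G Y -> open Y.
  move=> [A [AF _ ->]]; apply: open_bigcap_finite => [|X /AF/hF[]//].
  exact: sub_finite_set AF finF.
have Gconnected Y : G Y -> connected Y.
  by move=> [A [AF A0 ->]]; case: (hcap A AF A0) => // ->; apply: connected0.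
have Gcap : closed_bigcap G by apply: intersections_bigcap.
have GB i : G (B i).
  exists [set B i]; split; [by move=> _ ->|by exists (B i)|].
  by rewrite bigcap_set1.
have rG := plane_radon Gopen Gconnected Gcap.
have fifteen := plane_quadruple_among_fifteen Gopen Gconnected Gcap.
have I0 : 0 < #|'I_n.+1| by rewrite card_ord.
have [J e J0|Q [x [Q0 hQ]]] := hc 'I_n.+1 B I0.
  apply: (hD G) => //; apply: (@thick_intersectsb_pick _ _ _ 'I_(2 * p) _ 1 xpredT) => //.
    by rewrite /thick mul1n; apply: subset_leq_card; apply/fintype.subsetP.
  move=> V _; apply: (pq_three_positions (fun a => e (V a)) _ pqF BI FB) => [|i].
    by rewrite hq.
  by have [] := hF _ (FB i).
have [s sN hs] := hN G _ B Q x rG Gcap GB Q0 hQ.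
exists s => // X /fS[i /= ni <-]; exact: (hs (Ordinal ni)).
Qed.
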